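(* Let $\{f_k\}_{k=1}^n$ be a frame for $\mathbb{C}^d$ with synthesis operator $\Theta:\mathbb{C}^n\to\mathbb{C}^d$. Then $\{f_k\}_{k=1}^n$ is a cyclic frame if and only if $\ker(\Theta)$ is invariant under the (cyclic) right shift operator $R:\mathbb{C}^n\to\mathbb{C}^n$, i.e., $R(\ker(\Theta))\subseteq\ker(\Theta)$.
   Context: A finite family in $\mathbb{C}^d$ is a frame for $\mathbb{C}^d$ iff it spans $\mathbb{C}^d$. The synthesis operator of $\{f_k\}_{k=1}^n$ is $\Theta x=\sum_{k=1}^n x(k)f_k$ for $x=(x(1),\dots,x(n))\in\mathbb{C}^n$. The (cyclic) right shift operator $R:\mathbb{C}^n\to\mathbb{C}^n$ is $R(x(1),x(2),\dots,x(n))=(x(n),x(1),\dots,x(n-1))$. A frame $\{f_k\}_{k=1}^n$ for $\mathbb{C}^d$ (an ordered family) is called a cyclic frame if there exists a linear operator $T:\mathbb{C}^d\to\mathbb{C}^d$ such that $f_k=T^{k-1}f_1$ for $1\le k\le n$ and $T^n=I$ (the identity operator). *)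

(* Defs.v *)
From HB Require Import structures.
From mathcomp Require Import all_boot all_order all_algebra.
From mathcomp Require Import reals.
From mathcomp Require Import complex.

Set Implicit Arguments.
Unset Strict Implicit.
Unset Printing Implicit Defensive.

Import GRing.Theory.
Local Open Scope ring_scope.
Local Open Scope complex_scope.

Section CyclicFrames.
Variable R : realType.
Local Notation C := R[i].

Definition is_frame (d n : nat) (f : 'I_n -> 'cV[C]_d) : Prop :=
  <<codom f>>%VS = fullv.

Definition synthesis_fun (d n : nat) (f : 'I_n -> 'cV[C]_d) (x : 'cV[C]_n) :
    'cV[C]_d :=
  \sum_(k < n) x k 0 *: f k.

Lemma synthesis_fun_is_linear d n (f : 'I_n -> 'cV[C]_d) :
  linear (synthesis_fun f).
Proof.
move=> a x y; rewrite /synthesis_fun scaler_sumr -big_split /=.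
by apply: eq_bigr => k _; rewrite !mxE scalerDl scalerA.
Qed.

HB.instance Definition _ d n (f : 'I_n -> 'cV[C]_d) :=
  GRing.isLinear.Build C 'cV[C]_n 'cV[C]_d *:%R (synthesis_fun f)
    (synthesis_fun_is_linear f).

Definition synthesis (d n : nat) (f : 'I_n -> 'cV[C]_d) :
    'Hom('cV[C]_n, 'cV[C]_d) :=
  linfun (synthesis_fun f).

Lemma synthesisE d n (f : 'I_n -> 'cV[C]_d) (x : 'cV[C]_n) :
  synthesis f x = \sum_(k < n) x k 0 *: f k.
Proof. exact: lfunE. Qed.

(* [ord_pred] is the cyclic predecessor, so entry 0 of the image is the last
   entry of [x]. *)
Definition right_shift_fun (n : nat) (x : 'cV[C]_n) : 'cV[C]_n :=
  \col_(i < n) x (ord_pred i) 0.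

Lemma right_shift_fun_is_linear n : linear (@right_shift_fun n).
Proof. by move=> a x y; apply/colP => i; rewrite !mxE. Qed.

HB.instance Definition _ n :=
  GRing.isLinear.Build C 'cV[C]_n 'cV[C]_n *:%R (@right_shift_fun n)
    (@right_shift_fun_is_linear n).

Definition right_shift (n : nat) : 'End('cV[C]_n) :=
  linfun (@right_shift_fun n).

Lemma right_shiftE n (x : 'cV[C]_n) (i : 'I_n) :
  right_shift n x i 0 = x (ord_pred i) 0.
Proof. by rewrite lfunE /= mxE. Qed.

(* Indices start at 0 and a family has [n.+1] members, so the vector indexed by
   [k : 'I_n.+1] is the (k+1)-st one and is the image of the first one under
   the k-th power of the operator. *)
Definition is_cyclic_frame (d n : nat) (f : 'I_n.+1 -> 'cV[C]_d) : Prop :=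
  is_frame f /\
  exists T : 'End('cV[C]_d),
    (forall k : 'I_n.+1, f k = iter k T (f ord0)) /\
    (forall v : 'cV[C]_d, iter n.+1 T v = v).

End CyclicFrames.

Arguments right_shift R n : clear implicits.

(* Main.v *)
Require Import Defs.
From mathcomp Require Import all_boot all_order all_algebra.
From mathcomp Require Import reals.
From mathcomp Require Import complex.

Local Open Scope ring_scope.
Local Open Scope complex_scope.

(** The proof rests on one intertwining relation.  Write Theta for the synthesis
    operator and S for the cyclic right shift.  Since Theta sends the canonical
    basis to the family and S permutes the canonical basis cyclically, an
    operator T on C^d satisfies T Theta = Theta S exactly when it moves the family
    cyclically: T f_k = f_(k+1), indices modulo the length
    ([intertwines_shiftP]).  Cyclic motion is in turn the same as being a witness
    of cyclicity, once the family spans: T f_k = f_(k+1) along the family means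
    f_k = T^k f_0, and the wrap-around step from the last vector to the first
    means that T^(n+1) fixes f_0, hence every f_k, hence all of C^d
    ([cyclic_stepP]).

    It remains to see when some T satisfies T Theta = Theta S.  If one does, S
    maps ker Theta into itself.  Conversely, a frame is a family whose Theta is
    onto, so if S preserves ker Theta, then S descends to the quotient
    C^(n+1) / ker Theta = C^d; concretely T = Theta S P with P a linear right
    inverse of Theta ([intertwiner_exists]). *)

Section CyclicFrameCriterion.
Import GRing.Theory.
Variables (R : realType) (d : nat).
Local Notation C := R[i].

Lemma synthesis_delta {n : nat} (f : 'I_n -> 'cV[C]_d) (k : 'I_n) :
  synthesis f (delta_mx k 0) = f k.
Proof.
rewrite synthesisE (bigD1 k) //= mxE !eqxx scale1r big1 ?addr0 // => i ik.
by rewrite mxE (negPf ik) scale0r.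
Qed.

Lemma frame_synthesis_surj {n : nat} (f : 'I_n -> 'cV[C]_d) :
  is_frame f -> limg (synthesis f) = fullv.
Proof.
move=> hf; apply/eqP; rewrite eqEsubv subvf -hf.
apply/span_subvP => _ /codomP[k ->].
by rewrite -synthesis_delta memv_img ?memvf.
Qed.

Lemma frame_synthesisP {n : nat} (f : 'I_n -> 'cV[C]_d) :
  is_frame f -> forall v, exists x, v = synthesis f x.
Proof.
move=> hf v; have fS := frame_synthesis_surj f hf.
have /memv_imgP[x _ ->] : v \in limg (synthesis f) by rewrite fS memvf.
by exists x.
Qed.

(** Reindexing the synthesis sum by the cyclic permutation moves the shift from
    the coefficients to the vectors. *)
Lemma synthesis_shift {n : nat} (f : 'I_n -> 'cV[C]_d) (x : 'cV[C]_n) :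
  synthesis f (right_shift R n x) = \sum_(k < n) x k 0 *: f (ordS k).
Proof.
rewrite synthesisE (reindex_inj (can_inj (@ordSK n))) /=.
by apply: eq_bigr => k _; rewrite right_shiftE ordSK.
Qed.

Lemma intertwines_shiftP {n : nat} (f : 'I_n -> 'cV[C]_d) (T : 'End('cV[C]_d)) :
  (forall x, T (synthesis f x) = synthesis f (right_shift R n x)) <->
  (forall k, T (f k) = f (ordS k)).
Proof.
split=> [TS k | Tf x].
  rewrite -(synthesis_delta f k) TS synthesis_shift (bigD1 k) //= mxE !eqxx.
  rewrite scale1r big1 ?addr0 // => i ik.
  by rewrite mxE (negPf ik) scale0r.
rewrite synthesis_shift synthesisE linear_sum.
by apply: eq_bigr => k _; rewrite linearZ /= Tf.
Qed.

(** Theta S is constant on the fibres of Theta because S preserves ker Theta; and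
    x and P (Theta x) lie in the same fibre for any right inverse P of Theta. *)
Lemma intertwiner_exists {n : nat} (f : 'I_n -> 'cV[C]_d) :
  is_frame f ->
  (right_shift R n @: lker (synthesis f) <= lker (synthesis f))%VS ->
  exists T : 'End('cV[C]_d),
    forall x, T (synthesis f x) = synthesis f (right_shift R n x).
Proof.
move=> hf inv.
exists (synthesis f \o right_shift R n \o (synthesis f)^-1)%VF => x.
rewrite !comp_lfunE; apply/eqP; rewrite -subr_eq0 -!linearB /= -memv_ker.
apply: (subvP inv); apply: memv_img.
rewrite memv_ker linearB /= limg_lfunVK ?subrr //.
by rewrite (frame_synthesis_surj f hf) memvf.
Qed.

Lemma iter_lfun_synthesis {n : nat} (f : 'I_n -> 'cV[C]_d) (T : 'End('cV[C]_d))
    (m : nat) (x : 'cV[C]_n) :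
  iter m T (synthesis f x) = \sum_(k < n) x k 0 *: iter m T (f k).
Proof.
rewrite synthesisE; elim: m => //= m ->.
by rewrite linear_sum; apply: eq_bigr => k _; rewrite linearZ.
Qed.

Lemma cyclic_stepP {n : nat} (f : 'I_n.+1 -> 'cV[C]_d) (T : 'End('cV[C]_d)) :
  is_frame f ->
  (forall k : 'I_n.+1, f k = iter k T (f ord0)) /\
    (forall v, iter n.+1 T v = v) <->
  (forall k, T (f k) = f (ordS k)).
Proof.
have wrap : ordS (@ord_max n) = ord0 by apply: val_inj; rewrite /= modnn.
move=> hf; split=> [[fE Tn] k | Tf].
  have := ltn_ord k; rewrite ltnS leq_eqVlt => /orP[/eqP kn | kn].
    have -> : k = ord_max by apply: val_inj.
    by rewrite wrap (fE ord_max) -iterS Tn.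
  by rewrite (fE k) (fE (ordS k)) /= modn_small.
have fE (k : 'I_n.+1) : f k = iter k T (f ord0).
  case: k => m; elim: m => [|m IH] lt_m; first by congr f; apply: val_inj.
  rewrite /= -(IH (ltnW lt_m)) Tf; congr f; apply: val_inj.
  by rewrite /= modn_small.
split=> // v; have [x ->] := frame_synthesisP f hf v.
rewrite iter_lfun_synthesis synthesisE; apply: eq_bigr => k _; congr (_ *: _).
(* Powers of T commute, so it is enough that T^(n+1) fixes f_0. *)
by rewrite (fE k) -iterD addnC iterD iterS -(fE ord_max) Tf wrap.
Qed.

End CyclicFrameCriterion.

Theorem theorem3p7 (R : realType) (d n : nat) (f : 'I_n.+1 -> 'cV[R[i]]_d)
    (hf : is_frame f) :
  is_cyclic_frame f <->
  (right_shift R n.+1 @: lker (synthesis f) <= lker (synthesis f))%VS.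
Proof.
split=> [[_ [T /(cyclic_stepP _ _ _ _ hf)/intertwines_shiftP TS]] | inv].
  apply/subvP => _ /memv_imgP[x + ->]; rewrite !memv_ker => /eqP x0.
  by rewrite -TS x0 GRing.linear0.
have [T /intertwines_shiftP Tf] := intertwiner_exists _ _ _ hf inv.
by split=> //; exists T; apply/cyclic_stepP.
Qed.
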